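(* Let $k,m,n$ be positive integers and $\varepsilon=\exp(2\pi\sqrt{-1}/k)$. Let $T,B\in Mat_n(\mathbb{C})$ be matrices such that $B^k=\mathbf 1$, $BT=\varepsilon\,TB$. Fix generic numbers $\lambda_1,\dots,\lambda_m,t_1,\dots,t_m\in\mathbb{C}$ such that $T^k-\lambda_\alpha^k\mathbf 1$ is invertible for all $\alpha=1,\dots,m$. Let $\circ$ be the multiplication $x\circ y=R(x)y+xR(y)-R(xy)$ on $(Mat_n)^m$, where $R(x)=(R_1(x),\dots,R_m(x))$ and $$R_\alpha(x)=\sum_{(i,\beta)\ne(0,\alpha)}\frac{t_\beta}{\varepsilon^i\lambda_\beta-\lambda_\alpha}\cdot\frac{T-\lambda_\alpha}{\varepsilon^{-i}T-\lambda_\beta}B^{-i}x_\beta B^i+\Big(\frac{t_\alpha}{T-\lambda_\alpha}-\sum_{(i,\beta)\ne(0,\alpha)}\frac{\varepsilon^i t_\beta}{\varepsilon^i\lambda_\beta-\lambda_\alpha}\Big)x_\alpha .$$ Let $\mu_\alpha=\mu_\alpha(\lambda)$, $\alpha=1,\dots,m$, be algebraic functions in $\lambda$ such that $\mu_\alpha(0)=\lambda_\alpha$ and $$\sum_{\gamma}\frac{t_\gamma\lambda_\gamma^{k-1}}{\lambda_\gamma^k-\mu_\alpha^k}=\frac{1}{k\lambda},\qquad\alpha=1,\dots,m .$$ Then: (a) The operator $S_\lambda=\mathbf 1+R\,\lambda+O(\lambda^2)$ with the property $S_\lambda(x)\,S_\lambda(y)=S_\lambda(xy+\lambda\,x\circ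 y)$ is given by $S_\lambda(x)=(S_1(x),\dots,S_m(x))$, where $$S_\alpha(x)=\sum_{i,\beta}\frac{\lambda\,t_\beta\,(T-\mu_\alpha)}{(\varepsilon^i\lambda_\beta-\mu_\alpha)(\varepsilon^{-i}T-\lambda_\beta)}B^{-i}x_\beta B^i .$$ (b) The Lax operator $L(x)=(S_\lambda^{-1})^*(x)$ is defined by the formulas $L(x)=(L_1(x),\dots,L_m(x))$, where $$L_\alpha(x)=-\sum_{i,\beta}\frac{\prod_s(\lambda_\alpha^k-\mu_s^k)(\lambda_s^k-\mu_\beta^k)}{k^2\lambda_\alpha^{k-1}\mu_\beta^{k-1}(\lambda_\alpha-\varepsilon^i\mu_\beta)\prod_{s\ne\alpha}(\lambda_\alpha^k-\lambda_s^k)\prod_{s\ne\beta}(\mu_\beta^k-\mu_s^k)}\cdot B^i x_\beta\,\frac{T-\lambda_\alpha}{t_\alpha\,\lambda\,(\varepsilon^{-i}T-\mu_\beta)}B^{-i}.$$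
   Context: $Mat_n=Mat_n(\mathbb{C})$ is the algebra of complex $n\times n$ matrices and $\mathbf 1$ denotes the identity (matrix or operator). Elements of $(Mat_n)^m$, the direct sum of $m$ copies of $Mat_n$, are written $x=(x_1,\dots,x_m)$ with $x_\alpha\in Mat_n$, and the standard product is $xy=(x_1y_1,\dots,x_my_m)$. The multiplication $\circ$ is associative and compatible with the standard product, i.e. $xy+\lambda\,x\circ y$ is an associative product for every constant $\lambda$. For a linear operator $Q$ on $(Mat_n)^m$, the adjoint $Q^*$ is taken with respect to the trace form $\sum_{\alpha}\mathrm{trace}(x_\alpha y_\alpha)$. The operator $L$ is the Lax operator of the equation $\frac{dx}{dt}=[R(x)+R^*(x),x]$, in the Lax representation $\frac{dL}{dt}=[A,L]$ with $A=\frac1\lambda S_\lambda(x)$. Sums over $(i,\beta)$ run over $0\le i\le k-1$, $1\le\beta\le m$ (omitting a pair where indicated); $s$ and $\gamma$ run over $1,\dots,m$, and the product $\prod_s$ in the numerator of $L_\alpha$ is over both factors that follow it. Scalars in expressions with $T$ mean multiples of $\mathbf 1$, and fractions with $T$ denote commuting rational functions of $T$, e.g. $\frac{T-\lambda_\alpha}{\varepsilon^{-i}T-\lambda_\beta}=(T-\lambda_\alpha\mathbf 1)(\varepsilon^{-i}T-\lambda_\beta\mathbf 1)^{-1}$.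
   Formalization: The printed formula for L_α in (b) is false (for k=m=1 it gives −(S_λ^{-1})^* ). The formal statement uses the sign (−1)^{m−1} instead of −1 and exchanges α and β everywhere except in x_β. *)

(* Defs.v *)
(* MathComp / MathComp-Analysis; the complex numbers are R[i] for R : realType. *)
From HB Require Import structures.
From mathcomp Require Import all_boot all_order all_algebra complex.
From mathcomp Require Import all_classical all_reals all_analysis.
Import Order.TTheory GRing.Theory Num.Theory.
Import numFieldNormedType.Exports.

Set Implicit Arguments.
Unset Strict Implicit.
Unset Printing Implicit Defensive.

Local Open Scope classical_set_scope.
Local Open Scope ring_scope.

(* R[i] packaged as a numClosedFieldType, so that it carries the topology and
   norm that MathComp-Analysis puts on every such field. *)
Definition Cplx (R : realType) : numClosedFieldType := R[i].

(* exp (sqrt(-1) * x) *)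
Definition expi (R : realType) (x : R) : Cplx R := (cos x +i* sin x)%C.

(* The direct sum of m copies of Mat_n. Its library ring structure is the
   componentwise product. *)
Notation matsum K m n := {ffun 'I_m -> 'M[K]_n}.

Section Adjoint.
Variables (K : fieldType) (m n : nat).
Local Notation V := (matsum K m n).

Definition trform (x y : V) : K := \sum_a \tr (x a *m y a).

Definition unitvec (a : 'I_m) (i j : 'I_n) : V :=
  [ffun b => if b == a then delta_mx i j else 0].

(* Adjoint of a linear operator for trform (see adjointP, adjoint_unique):
   since \tr (delta_mx j i *m M) = M i j, the (i, j) entry in component a of
   a vector v is trform (unitvec a j i) v. *)
Definition adjoint (Q : V -> V) (y : V) : V :=
  [ffun a => \matrix_(i, j) trform (Q (unitvec a j i)) y].

Lemma trform_unitvec (a : 'I_m) (i j : 'I_n) (v : V) :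
  trform (unitvec a j i) v = v a i j.
Proof.
rewrite /trform (bigD1 a) //= big1 ?addr0 => [|b /negbTE ba]; last first.
  by rewrite ffunE ba mul0mx mxtrace0.
rewrite ffunE eqxx mxtrace_mulC /mxtrace (bigD1 i) //= big1 ?addr0 => [|c ci].
  rewrite mxE (bigD1 j) //= big1 ?addr0 => [|d dj].
    by rewrite mxE !eqxx mulr1.
  by rewrite mxE (negbTE dj) mulr0.
by rewrite mxE big1 // => d _; rewrite mxE (negbTE ci) andbF mulr0.
Qed.

Lemma unitvec_sum (x : V) :
  x = \sum_a \sum_i \sum_j x a i j *: unitvec a i j.
Proof.
have sumE I (r : seq I) (F : I -> V) b :
    (\sum_(i <- r) F i) b = \sum_(i <- r) F i b.
  by apply: (big_morph (fun f : V => f b)) => [f g|]; rewrite ffunE.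
apply/ffunP => b; rewrite sumE (bigD1 b) //= [X in _ + X]big1 ?addr0 => [|a ab].
  rewrite sumE {1}[x b]matrix_sum_delta; apply: eq_bigr => i _.
  by rewrite sumE; apply: eq_bigr => j _; rewrite !ffunE eqxx.
rewrite sumE big1 // => i _; rewrite sumE big1 // => j _.
by rewrite !ffunE eq_sym (negbTE ab) scaler0.
Qed.

Lemma adjointP (Q : {linear V -> V}) (x y : V) :
  trform (Q x) y = trform x (adjoint Q y).
Proof.
have formE (f : {linear V -> V}) (z : V) :
    trform (f x) z = \sum_a \sum_i \sum_j x a i j * trform (f (unitvec a i j)) z.
  have Dl (u v : V) : trform (u + v) z = trform u z + trform v z.
    rewrite /trform -big_split; apply: eq_bigr => a _ /=.
    by rewrite ffunE mulmxDl mxtraceD.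
  have T0 : trform 0 z = 0.
    by rewrite /trform big1 // => a _; rewrite ffunE mul0mx mxtrace0.
  have Zl c (u : V) : trform (c *: u) z = c * trform u z.
    rewrite /trform mulr_sumr; apply: eq_bigr => a _.
    by rewrite ffunE -scalemxAl mxtraceZ.
  have Sl I (r : seq I) (F : I -> V) :
      trform (\sum_(i <- r) F i) z = \sum_(i <- r) trform (F i) z.
    exact: (big_morph (fun u => trform u z) Dl T0).
  rewrite {1}[x]unitvec_sum linear_sum Sl; apply: eq_bigr => a _.
  rewrite linear_sum Sl; apply: eq_bigr => i _.
  by rewrite linear_sum Sl; apply: eq_bigr => j _; rewrite linearZ Zl.
rewrite formE (formE idfun (adjoint Q y)); apply: eq_bigr => a _.
apply: eq_bigr => i _; apply: eq_bigr => j _.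
by rewrite /= trform_unitvec !ffunE mxE.
Qed.

Lemma adjoint_unique (Q Q' : V -> V) :
  (forall x y, trform (Q x) y = trform x (Q' y)) -> Q' =1 adjoint Q.
Proof.
move=> QQ' y; apply/ffunP => a; apply/matrixP => i j.
by rewrite ffunE mxE QQ' trform_unitvec.
Qed.

End Adjoint.

Section Operators.
Variables (K : fieldType) (k m n : nat) (eps : K) (T B : 'M[K]_n).
Variables (lam t : 'I_m -> K).
Local Notation V := (matsum K m n).

(* (T - a)/(eps^{-i} T - b) *)
Definition Tfrac (i : nat) (a b : K) : 'M[K]_n :=
  (T - a%:M) *m invmx (eps ^- i *: T - b%:M).

(* Genericity: all scalar denominators in R and in L that do not involve mu
   are nonzero. *)
Definition generic_parameters : Prop :=
  (forall a, t a != 0) /\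
  (forall (i : 'I_k) (a b : 'I_m),
     (i != 0 :> nat) || (b != a) -> eps ^+ i * lam b - lam a != 0).

Definition Rop (x : V) : V := [ffun a =>
  \sum_(i < k) \sum_(b < m | (i != 0 :> nat) || (b != a))
     (t b / (eps ^+ i * lam b - lam a)) *:
       (Tfrac i (lam a) (lam b) *m (invmx B ^+ i *m x b *m B ^+ i))
  + (t a *: invmx (T - (lam a)%:M)
     - (\sum_(i < k) \sum_(b < m | (i != 0 :> nat) || (b != a))
          eps ^+ i * t b / (eps ^+ i * lam b - lam a))%:M) *m x a].

Definition circ (x y : V) : V := Rop x * y + x * Rop y - Rop (x * y).

(* Below, l is the spectral parameter lambda and mu the values mu_a(l). *)
Definition Sop (l : K) (mu : 'I_m -> K) (x : V) : V := [ffun a =>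
  \sum_(i < k) \sum_(b < m)
     (l * t b / (eps ^+ i * lam b - mu a)) *:
       (Tfrac i (mu a) (lam b) *m (invmx B ^+ i *m x b *m B ^+ i))].

(* Scalar coefficient, for the pair (lam_a, mu_b) and the power i, in the
   inverse of the Cauchy-type matrix (1 / (eps^i lam_b - mu_a)). *)
Definition Lcoef (mu : 'I_m -> K) (i : nat) (a b : 'I_m) : K :=
  (\prod_(s < m) ((lam a ^+ k - mu s ^+ k) * (lam s ^+ k - mu b ^+ k))) /
  (k%:R ^+ 2 * lam a ^+ k.-1 * mu b ^+ k.-1 * (lam a - eps ^+ i * mu b)
   * (\prod_(s < m | s != a) (lam a ^+ k - lam s ^+ k))
   * (\prod_(s < m | s != b) (mu b ^+ k - mu s ^+ k))).

(* The sign is (-1)^(m-1), and the pair (lam, t) carries the summation index b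
   while mu carries the component index a. The formula also occurs in print
   with the sign -1 and with a and b interchanged everywhere except in x_b.
   That version is not the adjoint of the inverse of Sop: for m = 1 it is its
   opposite, and for m > 1 it lacks the transposition of the component indices
   which passing to the adjoint requires. *)
Definition Lop (l : K) (mu : 'I_m -> K) (x : V) : V := [ffun a =>
  (-1) ^+ m.-1 *:
  \sum_(i < k) \sum_(b < m)
     Lcoef mu i b a *:
       (B ^+ i *m x b *m ((t b * l)^-1 *: Tfrac i (lam b) (mu a))
        *m invmx B ^+ i)].

(* Nonvanishing of the denominators of Lop that is not already implied by the
   genericity of lam, t and by the equation for mu. *)
Definition Lop_defined (mu : 'I_m -> K) : Prop :=
  injective (fun b => mu b ^+ k) /\
  (forall b, mu b ^+ k.-1 != 0 /\ (T ^+ k - (mu b ^+ k)%:M) \in unitmx).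

End Operators.

Section Analysis.
Variables (K : numFieldType) (m n : nat).
Local Notation V := (matsum K m n).

(* A (single-valued, continuous) branch on U of an algebraic function; in
   P : {poly {poly K}} the outer variable is f(z) and the inner one is z. *)
Definition algebraic_function (U : set K) (f : K -> K) : Prop :=
  (forall z, U z -> {for z, continuous f}) /\
  (exists2 P : {poly {poly K}}, P != 0 &
     forall z, U z -> P.[(f z)%:P].[z] = 0).

Definition has_velocity (x : K -> V) (s : K) (v : V) : Prop :=
  forall a i j, is_derive s (1 : K) (fun u => x u a i j) (v a i j).

Definition comm (x y : V) : V := x * y - y * x.

(* dL(x)/ds = [A(x), L(x)] along every solution of dx/ds = F(x), on any set D
   of (complex) times. *)
Definition Lax_representation (F A L : V -> V) : Prop :=
  forall (D : set K) (x : K -> V),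
    (forall s, D s -> has_velocity x s (F (x s))) ->
    forall s, D s ->
      has_velocity (fun u => L (x u)) s (comm (A (x s)) (L (x s))).

End Analysis.

(* Main.v *)
(* Index the pairs w = (i, b) and put nu_w = eps^i lam_b, tau_w = eps^i t_b,
   X_w = B^-i x_b B^i and G_w = (T - nu_w)^-1. Then
     R(x)_w = \sum_u tau_u G_u X_u
              + \sum_(u != w) tau_u / (nu_u - nu_w) (X_u - X_w),
     S_a(x) = l \sum_w tau_w (1 / (nu_w - mu_a) + G_w) X_w,
   and the equation defining mu reads \sum_w tau_w / (nu_w - mu_a) = 1 / l.
   Multiplicativity of S follows from the resolvent identities for G_w and for
   1 / (nu_w - mu_a) by symmetrizing double sums over pairs (w, u); expanding S
   at l = 0 only needs mu_a - lam_a = O(l), again a consequence of the equation.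
   Composing S with the adjoint of L collapses all fractions of T into a single
   one, leaving the inversion of a Cauchy matrix in the k-th powers of lam and
   mu, that is, Lagrange interpolation. The Lax equation is obtained by pairing
   with S(y), using that S carries the deformed commutator to the commutator. *)
Require Import Defs.
From HB Require Import structures.
From mathcomp Require Import all_boot all_order all_algebra complex.
From mathcomp Require Import all_classical all_reals all_analysis.
From mathcomp Require Import ring zify.
Import Order.TTheory GRing.Theory Num.Theory.
Import numFieldNormedType.Exports.

Set Implicit Arguments.
Unset Strict Implicit.
Unset Printing Implicit Defensive.

Local Open Scope classical_set_scope.
Local Open Scope ring_scope.

(** * Sums over roots of unity and Cauchy matrices *)

(** Exponents of [eps] and [B] matter only modulo k. This allows a summation index to be translated
    in Z/k while exponents stay natural numbers. *)
Lemma periodic_sum_shift (V : zmodType) (k : nat) (f : nat -> V) (i : nat) :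
  (forall j, f (k + j)%N = f j) -> \sum_(j < k) f (i + j)%N = \sum_(j < k) f j.
Proof.
move=> fk; elim: i => [|i IH]; first by apply: eq_bigr.
rewrite -{}IH; case: k fk => [|k] fk; first by rewrite !big_ord0.
rewrite big_ord_recr [RHS]big_ord_recl addn0 /= [LHS]addrC; congr (_ + _).
  by rewrite -[RHS]fk addSnnS addnC.
by apply: eq_bigr => j _; rewrite addSnnS.
Qed.

Section RootSums.
Variables (K : fieldType) (k : nat) (eps : K).
Hypothesis eps_prim : k.-primitive_root eps.

(** Orthogonality of the characters of Z/k: if k does not divide e, multiplying by the nonzero
    [eps ^+ e - 1] makes the geometric sum telescope. *)
Lemma sum_exp_prim_root (e : nat) :
  \sum_(i < k) eps ^+ (i * e) = if (k %| e)%N then k%:R else 0.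
Proof.
case: ifPn => [ke|nke].
  rewrite (eq_bigr (fun=> 1)) ?sumr_const ?card_ord // => i _.
  by apply/eqP; rewrite -(prim_order_dvd eps_prim) dvdn_mull.
have e1 : eps ^+ e - 1 != 0 by rewrite subr_eq0 -(prim_order_dvd eps_prim).
apply: (mulfI e1); rewrite mulr0.
under eq_bigr do rewrite mulnC exprM.
by rewrite -subrX1 -exprM mulnC exprM (prim_expr_order eps_prim) expr1n subrr.
Qed.

Lemma eps_unity i : (eps ^+ i) ^+ k = 1.
Proof. by rewrite -exprM mulnC exprM (prim_expr_order eps_prim) expr1n. Qed.

Lemma root_sub_neq0 i (x u : K) : x ^+ k - u ^+ k != 0 -> eps ^+ i * x - u != 0.
Proof.
apply: contra_neq => /eqP; rewrite subr_eq0 => /eqP <-.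
by rewrite exprMn eps_unity mul1r subrr.
Qed.

(** Since [(eps ^+ i * x) ^+ k = x ^+ k], factoring a difference of k-th powers turns the reciprocal
    into a polynomial in [eps ^+ i] over a denominator free of i. *)
Let invE i (x u : K) : x ^+ k - u ^+ k != 0 ->
  (eps ^+ i * x - u)^-1 =
  (\sum_(j < k) (eps ^+ i * x) ^+ (k.-1 - j) * u ^+ j) / (x ^+ k - u ^+ k).
Proof.
move=> h; have h' := root_sub_neq0 i h.
have := subrXX (eps ^+ i * x) u k; rewrite exprMn eps_unity mul1r => E.
by rewrite E in h *; move: h; rewrite mulf_eq0 => /norP[? ?]; field; apply/andP.
Qed.

Lemma sum_root_inv (x u : K) : x ^+ k - u ^+ k != 0 ->
  \sum_(i < k) eps ^+ i / (eps ^+ i * x - u)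
  = k%:R * x ^+ k.-1 / (x ^+ k - u ^+ k).
Proof.
move=> h; have k0 : (0 < k)%N := prim_order_gt0 eps_prim.
under eq_bigr do rewrite (invE _ h) mulrA mulr_sumr.
rewrite -mulr_suml; congr (_ / _); rewrite exchange_big /=.
rewrite (bigD1 (Ordinal k0)) //= [X in _ + X]big1 ?addr0 => [|j j0].
  under eq_bigr => i _.
    rewrite subn0 mulr1 exprMn mulrA -exprS prednK // eps_unity mul1r; over.
  by rewrite sumr_const card_ord mulr_natl.
(* For j > 0 the exponent of [eps ^+ i] is k - j, strictly between 0 and k, so these terms sum to
   zero. *)
under eq_bigr => i _.
  rewrite exprMn !mulrA -exprM -exprD -mulrA.
  rewrite -mulnS (_ : (k.-1 - j).+1 = (k - j)%N); last first.
    by rewrite -subSn ?prednK // -ltnS prednK.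
  over.
rewrite -mulr_suml sum_exp_prim_root ifN ?mul0r // gtnNdvd ?subn_gt0 //.
by rewrite ltn_subrL k0 lt0n (_ : (j : nat) != 0%N).
Qed.

(** The sum over j is (u^k - v^k) / (u - v) written without division, so that u = v, the diagonal
    case of the later orthogonality relation, is covered. *)
Lemma sum_root_inv2 (x u v : K) : x ^+ k - u ^+ k != 0 -> x ^+ k - v ^+ k != 0 ->
  \sum_(i < k) eps ^+ i / ((eps ^+ i * x - u) * (eps ^+ i * x - v))
  = k%:R * x ^+ k.-1 * (\sum_(j < k) u ^+ (k.-1 - j) * v ^+ j)
    / ((x ^+ k - u ^+ k) * (x ^+ k - v ^+ k)).
Proof.
move=> hu hv; have k0 : (0 < k)%N := prim_order_gt0 eps_prim.
under eq_bigr => i _.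
  rewrite invfM (invE _ hu) (invE _ hv) mulrACA -invfM mulrA; over.
rewrite -mulr_suml; congr (_ / _).
have powE a b c d :
    \sum_(i < k) eps ^+ i * ((eps ^+ i * x) ^+ a * u ^+ b * ((eps ^+ i * x) ^+ c * v ^+ d))
    = (if (k %| (a + c).+1)%N then k%:R else 0) * (x ^+ (a + c) * (u ^+ b * v ^+ d)).
  rewrite -sum_exp_prim_root mulr_suml; apply: eq_bigr => i _.
  by rewrite mulnS mulnDr !exprD !exprMn !exprM; ring.
under eq_bigr do rewrite big_distrlr mulr_sumr /=.
(* Reversing one index makes the total exponent of [eps ^+ i] equal to k + j - j', so only j' = j
   contributes. *)
rewrite exchange_big (reindex_inj rev_ord_inj) /= mulr_sumr; apply: eq_bigr => j _.
under eq_bigr do rewrite mulr_sumr.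
have jk := ltn_ord j.
rewrite exchange_big (bigD1 j) //= [X in _ + X]big1 ?addr0 => [|j' jj'].
  rewrite powE (_ : (k.-1 - (k - j.+1) + (k.-1 - j) = k.-1)%N); last by lia.
  by rewrite prednK // dvdnn mulrA (_ : (k - j.+1 = k.-1 - j)%N) //; lia.
rewrite powE ifN ?mul0r //; have jk' := ltn_ord j'.
apply: contra jj' => /dvdnP [q qE]; apply/eqP/val_inj => /=.
have {}qE : (k + j = q * k + j')%N by lia.
have := congr1 (modn^~ k) qE.
by rewrite modnDl modnMDl !modn_small.
Qed.

End RootSums.

(** * Lagrange interpolation and the inversion of a Cauchy matrix *)

Section Cauchy.
Variables (K : fieldType) (m : nat) (x y : 'I_m -> K).
Hypothesis x_inj : injective x.
Hypothesis xy : forall a b, x a - y b != 0.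

(** Both [p] and the interpolant [q] have size at most m and they agree at m distinct points, so
    [p - q] is zero. *)
Lemma lagrange_interpolation (p : {poly K}) (z : K) : (size p <= m)%N ->
  p.[z] = \sum_b p.[x b] * \prod_(s < m | s != b) ((z - x s) / (x b - x s)).
Proof.
move=> sp.
pose q := \sum_b p.[x b] *: \prod_(s < m | s != b) ((x b - x s)^-1 *: ('X - (x s)%:P)).
have qE w : q.[w] = \sum_b p.[x b] * \prod_(s < m | s != b) ((w - x s) / (x b - x s)).
  rewrite /q horner_sum; apply: eq_bigr => b _.
  rewrite hornerZ horner_prod; congr (_ * _); apply: eq_bigr => s _.
  by rewrite hornerZ hornerXsubC mulrC.
suff pq : p - q = 0 by rewrite -qE; apply/eqP; rewrite -subr_eq0 -hornerN -hornerD pq horner0.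
apply: (@roots_geq_poly_eq0 _ _ [seq x b | b : 'I_m]).
- apply/allP => _ /mapP[b _ ->]; rewrite /root hornerD hornerN qE (bigD1 b) //=.
  rewrite [X in _ - (_ + X)]big1 ?addr0 => [|c cb].
    rewrite big1 ?mulr1 ?subrr // => s sb; rewrite divff // subr_eq0.
    by apply: contra_neq sb => /x_inj.
  by rewrite (bigD1 b) /= 1?eq_sym // subrr !mul0r mulr0.
- by rewrite map_inj_uniq ?enum_uniq.
- rewrite size_map size_enum_ord (leq_trans (size_polyD _ _)) // size_polyN geq_max sp.
  rewrite (leq_trans (size_sum _ _ _)) //; apply/bigmax_leqP => b _.
  rewrite (leq_trans (size_scale_leq _ _)) // scaler_prod.
  rewrite (leq_trans (size_scale_leq _ _)) // size_prod => [|s _]; last by rewrite polyXsubC_eq0.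
  under eq_bigr do rewrite size_XsubC.
  by rewrite sum_nat_const cardC1 card_ord; have := ltn_ord b; lia.
Qed.

(** Interpolate [p], the product of X - y_s over s != c, at the nodes x_b and evaluate at y_a: the
    value is zero unless a = c, and division by the product of all y_a - x_s gives the relation. *)
Lemma cauchy_orthogonality (a c : 'I_m) :
  \sum_b (\prod_s (x b - y s)) /
    ((x b - y a) * (x b - y c) * \prod_(s < m | s != b) (x b - x s))
  = - (a == c)%:R * (\prod_(s < m | s != a) (y a - y s) / \prod_s (y a - x s)).
Proof.
have yx b : y a - x b != 0 by rewrite -opprB oppr_eq0.
pose p := \prod_(s < m | s != c) ('X - (y s)%:P).
have pE z : p.[z] = \prod_(s < m | s != c) (z - y s).
  by rewrite horner_prod; apply: eq_bigr => s _; rewrite hornerXsubC.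
have sp : (size p <= m)%N.
  rewrite size_prod => [|s _]; last by rewrite polyXsubC_eq0.
  under eq_bigr do rewrite size_XsubC.
  by rewrite sum_nat_const cardC1 card_ord; have := ltn_ord c; lia.
rewrite mulNr.
have -> : (a == c)%:R * (\prod_(s < m | s != a) (y a - y s) / \prod_s (y a - x s))
    = p.[y a] / \prod_s (y a - x s).
  have [ac|ac] := eqVneq a c; first by rewrite mul1r pE ac.
  by rewrite mul0r pE (bigD1 a) //= subrr !mul0r.
rewrite (lagrange_interpolation (y a) sp) mulr_suml -sumrN.
apply: eq_bigr => b _; rewrite pE (bigD1 c) //= prodf_div [\prod_s (y a - x s)](bigD1 b) //=.
set P := \prod_(s < m | s != c) _; set Q := \prod_(s < m | s != b) (x b - _).
set S := \prod_(s < m | s != b) _.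
have Q0 : Q != 0.
  by apply/prodf_neq0 => s sb; rewrite subr_eq0; apply: contra_neq sb => /x_inj.
have S0 : S != 0 by apply/prodf_neq0.
by field; rewrite Q0 S0 yx !xy.
Qed.
End Cauchy.

(** * Products of sums of resolvents *)

Section ProductIdentity.
Variables (K : numFieldType) (n : nat) (W : finType).
Variables (tau nu p : W -> K) (G : W -> 'M[K]_n).

Definition resolvent_sum (X : W -> 'M[K]_n) : 'M[K]_n :=
  \sum_u tau u *: (G u *m X u).

(* The term u = w of the second sum vanishes, whatever the value of tau w / 0. *)
Definition Rsum (X : W -> 'M[K]_n) (w : W) : 'M[K]_n :=
  resolvent_sum X + \sum_u (tau u / (nu u - nu w)) *: (X u - X w).

(** This is S_a(x) divided by l, with [p w] standing for 1 / (nu_w - mu_a), which enters the product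
    formula only through the identity [pB]. *)
Definition Fsum (X : W -> 'M[K]_n) : 'M[K]_n :=
  \sum_w tau w *: (((p w)%:M + G w) *m X w).

Hypothesis nu_inj : injective nu.
Hypothesis pB : forall u w, p w - p u = (nu u - nu w) * (p w * p u).
Hypothesis GB : forall u w, G w - G u = (nu w - nu u) *: (G w *m G u).
Hypothesis Gcomm : forall u w, G u *m G w = G w *m G u.

(** The identities [pB] and [GB] have opposite signs, so the difference of p_w + G_w and p_u + G_u
    is nu_u - nu_w times p_w p_u - G_w G_u. This cancels the denominators once the double sum is
    symmetrized. *)
Lemma Fsum_cross (X Y : W -> 'M[K]_n) :
  Fsum (fun w => \sum_u (tau u / (nu u - nu w)) *: ((X u - X w) *m (Y u - Y w)))
  = \sum_w \sum_u (tau w * tau u) *: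
      (((p w * p u)%:M - G w *m G u) *m (X u *m Y u - X w *m Y u)).
Proof.
pose B w u : 'M[K]_n := (tau w * tau u) *:
  (((p w * p u)%:M - G w *m G u) *m (X u *m Y u - X w *m Y u)).
(* A and B have the same symmetrization in (w, u). *)
pose A w u : 'M[K]_n := (tau w * tau u / (nu u - nu w)) *:
  (((p w)%:M + G w) *m ((X u - X w) *m (Y u - Y w))).
have -> : Fsum (fun w => \sum_u (tau u / (nu u - nu w)) *: ((X u - X w) *m (Y u - Y w)))
    = \sum_w \sum_u A w u.
  apply: eq_bigr => w _; rewrite mulmx_sumr scaler_sumr; apply: eq_bigr => u _.
  by rewrite -scalemxAr scalerA mulrA.
have AB w u : A w u + A u w = B w u + B u w.
  have [->|wu] := eqVneq u w; first by rewrite /A /B !subrr !mul0mx !mulmx0 !scaler0.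
  have nuwu : nu u - nu w != 0 by rewrite subr_eq0; apply: contra_neq wu => /nu_inj.
  have DE : (X w - X u) *m (Y w - Y u) = (X u - X w) *m (Y u - Y w).
    by rewrite -opprB -[Y w - _]opprB mulNmx mulmxN opprK.
  have -> : A w u + A u w = (tau w * tau u) *:
      (((p w * p u)%:M - G w *m G u) *m ((X u - X w) *m (Y u - Y w))).
    have cE : tau u * tau w / (nu w - nu u) = - (tau w * tau u / (nu u - nu w)).
      by rewrite -[nu w - _]opprB invrN mulrN [tau u * _]mulrC.
    have scB (c : K) (M N : 'M[K]_n) : c *: M + (- c) *: N = c *: (M - N).
      by rewrite scalerBr scaleNr.
    rewrite /A DE cE scB -mulmxBl opprD addrACA -raddfB /= pB GB.
    rewrite -[nu w - nu u]opprB -[((nu u - nu w) * _)%:M]scale_scalar_mx.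
    by rewrite scB -scalemxAl scalerA divfK.
  rewrite /B [p u * _]mulrC [tau u * _]mulrC Gcomm -scalerDr -mulmxDr; congr (_ *: (_ *m _)).
  rewrite mulmxBl !mulmxBr.
  by apply/matrixP => i j; rewrite ![in LHS]mxE ![in RHS]mxE; ring.
(* Doubling both sides allows each to be symmetrized by exchanging the summations; characteristic
   zero permits cancelling the 2. *)
have two0 : 2%:R != 0 :> K by rewrite pnatr_eq0.
apply: (scalerI two0); rewrite !scaler_nat !mulr2n.
rewrite [X in _ + X = _]exchange_big [X in _ = _ + X]exchange_big -!big_split.
by apply: eq_bigr => w _ /=; rewrite -!big_split; apply: eq_bigr => u _ /=.
Qed.

(** The deformed product splits into resolvent terms and a cross term with difference quotients.
    After [Fsum_cross] everything is a double sum over (w, u), and the identity holds term by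
    term. *)
Lemma Fsum_mul (X Y : W -> 'M[K]_n) :
  Fsum X *m Fsum Y =
  (\sum_w tau w * p w) *: Fsum (fun w => X w *m Y w)
  + Fsum (fun w => Rsum X w *m Y w + X w *m Rsum Y w - Rsum (fun u => X u *m Y u) w).
Proof.
pose Th := resolvent_sum.
have -> : Fsum (fun w => Rsum X w *m Y w + X w *m Rsum Y w - Rsum (fun u => X u *m Y u) w)
  = (Fsum (fun w => Th X *m Y w) + Fsum (fun w => X w *m Th Y)
    - Fsum (fun w => Th (fun u => X u *m Y u)))
    - Fsum (fun w => \sum_u (tau u / (nu u - nu w)) *: ((X u - X w) *m (Y u - Y w))).
  rewrite /Fsum -big_split -!sumrB; apply: eq_bigr => w _ /=.
  rewrite -scalerDr -!scalerBr -mulmxDr -!mulmxBr; congr (_ *: (_ *m _)).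
  rewrite /Rsum -/(Th X) -/(Th Y) -/(Th (fun u => X u *m Y u)) mulmxDl mulmxDr.
  (* The defect of the Leibniz rule for differences: X_u Y_u - X_w Y_w - (X_u - X_w) Y_w - X_w (Y_u
     - Y_w) equals (X_u - X_w)(Y_u - Y_w). *)
  have -> : \sum_u (tau u / (nu u - nu w)) *: ((X u - X w) *m (Y u - Y w)) =
    \sum_u (tau u / (nu u - nu w)) *: (X u *m Y u - X w *m Y w)
    - (\sum_u (tau u / (nu u - nu w)) *: (X u - X w)) *m Y w
    - X w *m (\sum_u (tau u / (nu u - nu w)) *: (Y u - Y w)).
    rewrite mulmx_suml mulmx_sumr -!sumrB; apply: eq_bigr => u _.
    rewrite -scalemxAl -scalemxAr -!scalerBr; congr (_ *: _).
    rewrite !mulmxBl !mulmxBr.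
    by apply/matrixP => i j; rewrite ![in LHS]mxE ![in RHS]mxE; ring.
  by apply/matrixP => i j; rewrite ![in LHS]mxE ![in RHS]mxE; ring.
rewrite Fsum_cross.
have -> : Fsum X *m Fsum Y = \sum_w \sum_u (tau w * tau u) *:
    (((p w)%:M + G w) *m X w *m (((p u)%:M + G u) *m Y u)).
  rewrite mulmx_suml; apply: eq_bigr => w _; rewrite mulmx_sumr; apply: eq_bigr => u _.
  by rewrite -scalemxAl -scalemxAr scalerA.
have -> : (\sum_w tau w * p w) *: Fsum (fun w => X w *m Y w) =
  \sum_w \sum_u (tau w * tau u) *: (p w *: (((p u)%:M + G u) *m (X u *m Y u))).
  rewrite scaler_suml; apply: eq_bigr => w _; rewrite scaler_sumr; apply: eq_bigr => u _.
  by rewrite !scalerA; congr (_ *: _); ring.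
have -> : Fsum (fun w => Th X *m Y w) =
  \sum_w \sum_u (tau w * tau u) *: (((p u)%:M + G u) *m G w *m (X w *m Y u)).
  rewrite exchange_big /=; apply: eq_bigr => u _; rewrite mulmx_suml mulmx_sumr scaler_sumr.
  apply: eq_bigr => w _; rewrite -scalemxAl -scalemxAr scalerA [tau u * _]mulrC.
  by rewrite !mulmxA.
have -> : Fsum (fun w => X w *m Th Y) =
  \sum_w \sum_u (tau w * tau u) *: (((p w)%:M + G w) *m X w *m (G u *m Y u)).
  apply: eq_bigr => w _; rewrite !mulmx_sumr scaler_sumr; apply: eq_bigr => u _.
  by rewrite -!scalemxAr scalerA mulmxA.
have -> : Fsum (fun w => Th (fun u => X u *m Y u)) =
  \sum_w \sum_u (tau w * tau u) *: (((p w)%:M + G w) *m G u *m (X u *m Y u)).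
  apply: eq_bigr => w _; rewrite !mulmx_sumr scaler_sumr; apply: eq_bigr => u _.
  by rewrite -!scalemxAr scalerA !mulmxA.
rewrite -big_split -!sumrB -!big_split; apply: eq_bigr => w _ /=.
rewrite -big_split -!sumrB -!big_split; apply: eq_bigr => u _ /=.
rewrite -!scalerDr -!scalerBr -!scalerDr; congr (_ *: _).
rewrite !(mulmxDl, mulmxBl, mulmxDr, mulmxBr, mul_scalar_mx, mul_mx_scalar, mulNmx, mulmxN, opprK,
  =^~ scalemxAl, =^~ scalemxAr, scalerDr, scalerBr, scalerA, mulmxA).

rewrite (Gcomm u w).
by apply/matrixP => i j; rewrite ![in LHS]mxE ![in RHS]mxE; ring.
Qed.

End ProductIdentity.

(** * Conjugation by powers of [B] and the resolvents of [T] *)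

Section Conjugation.
Variables (K : numFieldType) (n : nat) (B : 'M[K]_n).

Definition conj_by (i : nat) (M : 'M[K]_n) : 'M[K]_n :=
  invmx B ^+ i *m M *m B ^+ i.

Fact conj_by_is_linear i : linear (conj_by i).
Proof. by move=> c M N; rewrite /conj_by mulmxDr mulmxDl -scalemxAr -scalemxAl. Qed.

HB.instance Definition _ i :=
  GRing.isLinear.Build K 'M[K]_n 'M[K]_n _ (conj_by i) (conj_by_is_linear i).

Lemma conj_byD i j M : conj_by (i + j) M = conj_by i (conj_by j M).
Proof.
rewrite /conj_by exprD -mulmxE addnC exprD -mulmxE.
by rewrite !mulmxA.
Qed.

Variables (k : nat) (eps : K) (T : 'M[K]_n).
Hypotheses (eps_prim : k.-primitive_root eps).
Hypotheses (BkE : B ^+ k = 1%:M) (BTE : B *m T = eps *: (T *m B)).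

Lemma conj_base_unit : B \in unitmx.
Proof.
have := BkE; rewrite -(prednK (prim_order_gt0 eps_prim)) exprS.
by move/mulmx1_unit => [].
Qed.

Lemma mulXVmx i : B ^+ i *m invmx B ^+ i = 1%:M.
Proof.
elim: i => [|i IH]; first by rewrite !expr0 mulmx1.
rewrite exprSr exprS -!mulmxE mulmxA -(mulmxA (B ^+ i)) mulmxV ?conj_base_unit //.
by rewrite mulmx1.
Qed.

Lemma mulVXmx i : invmx B ^+ i *m B ^+ i = 1%:M.
Proof. exact/mulmx1C/mulXVmx. Qed.

Lemma conj_by_order M : conj_by k M = M.
Proof.
have /eqP := mulVXmx k; rewrite /conj_by BkE mulmx1 => /eqP ->.
by rewrite mulmx1 mul1mx.
Qed.

Lemma conj_by1mx i : conj_by i 1%:M = 1%:M.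
Proof. by rewrite /conj_by mulmx1 mulVXmx. Qed.

Lemma conj_byM i M N : conj_by i (M *m N) = conj_by i M *m conj_by i N.
Proof.
rewrite /conj_by !mulmxA -(mulmxA _ (B ^+ i) (invmx B ^+ i)) mulXVmx.
by rewrite mulmx1.
Qed.

Lemma conj_by_twist i : conj_by i T = eps ^- i *: T.
Proof.
have e0 : eps != 0 by rewrite (prim_root_eq0 eps_prim) -lt0n (prim_order_gt0 eps_prim).
elim: i => [|i IH]; first by rewrite expr0 invr1 scale1r /conj_by !expr0 mulmx1 mul1mx.
rewrite -addn1 conj_byD.
have -> : conj_by 1 T = eps^-1 *: T.
  apply: (scalerI e0); rewrite scalerA divff // scale1r /conj_by !expr1.
  by rewrite -mulmxA scalemxAr -BTE mulmxA mulVmx ?mul1mx ?conj_base_unit.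
by rewrite linearZ /= IH scalerA -invfM -exprS addn1.
Qed.

Definition resolvent (z : K) : 'M[K]_n := invmx (T - z%:M).

(** As [T] commutes with scalars, T - z is a factor of T^k - z^k. One condition on the k-th power
    thus controls the whole orbit of z under rotation by [eps]. *)
Lemma shift_unit (z : K) : T ^+ k - (z ^+ k)%:M \in unitmx -> T - z%:M \in unitmx.
Proof.
have cTz : GRing.comm T z%:M by rewrite /GRing.comm -mulmxE; exact/comm_mx_scalar.
have <- : (z%:M : 'M[K]_n) ^+ k = (z ^+ k)%:M.
  elim: (k) => [|i IH]; first by rewrite !expr0.
  by rewrite !exprS IH -mulmxE -scalar_mxM.
by rewrite subrXX_comm // -mulmxE unitmx_mul => /andP[].
Qed.

(** Conjugation turns T - z into eps^-i (T - eps^i z), so it rotates the point at which the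
    resolvent is taken. *)
Lemma conj_by_resolvent i z : T - z%:M \in unitmx -> T - (eps ^+ i * z)%:M \in unitmx ->
  conj_by i (resolvent z) = eps ^+ i *: resolvent (eps ^+ i * z).
Proof.
move=> uz uez.
have e0 : eps ^+ i != 0.
  by rewrite expf_neq0 // (prim_root_eq0 eps_prim) -lt0n (prim_order_gt0 eps_prim).
have : conj_by i (resolvent z) *m conj_by i (T - z%:M) = 1%:M.
  by rewrite -conj_byM mulVmx // conj_by1mx.
rewrite linearB /= -[z%:M]scalemx1 linearZ /= conj_by1mx conj_by_twist.
have -> : eps ^- i *: T - z *: 1%:M = eps ^- i *: (T - (eps ^+ i * z)%:M).
  by rewrite scalemx1 scalerBr scale_scalar_mx mulKf.
move=> E; have {}E : conj_by i (resolvent z) *m (T - (eps ^+ i * z)%:M) = eps ^+ i *: 1%:M.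
  by rewrite -E -scalemxAr scalerA divff // scale1r.
by rewrite -[LHS]mulmx1 -(mulmxV uez) mulmxA E -scalemxAl mul1mx.
Qed.

Lemma resolventM (a z : K) : T - z%:M \in unitmx ->
  (T - a%:M) *m resolvent z = 1%:M + (z - a) *: resolvent z.
Proof.
move=> uz; rewrite -mul_scalar_mx -[1%:M](mulmxV uz) -mulmxDl; congr (_ *m _).
by rewrite raddfB /= addrA subrK.
Qed.

Lemma resolventB (z w : K) : T - z%:M \in unitmx -> T - w%:M \in unitmx ->
  resolvent z - resolvent w = (z - w) *: (resolvent z *m resolvent w).
Proof.
move=> uz uw.
rewrite -[X in X - _ = _]mulmx1 -(mulmxV uw) -[X in _ - X = _]mul1mx -(mulVmx uz).
rewrite -mulmxA -mulmxBr -mulmxBl -/(resolvent w) -/(resolvent z).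
have -> : T - w%:M - (T - z%:M) = (z - w)%:M.
  by rewrite opprD opprK addrACA subrr add0r raddfB addrC.
by rewrite mul_scalar_mx scalemxAr.
Qed.

Lemma resolventC (z w : K) : T - z%:M \in unitmx -> T - w%:M \in unitmx ->
  resolvent z *m resolvent w = resolvent w *m resolvent z.
Proof.
move=> uz uw; have [->//|zw] := eqVneq z w.
have zw0 : z - w != 0 by rewrite subr_eq0.
apply: (scalerI zw0); rewrite -resolventB // -[RHS]opprK -scaleNr opprB -resolventB //.
by rewrite opprB.
Qed.

Lemma TfracE i a b : T - (eps ^+ i * b)%:M \in unitmx ->
  Tfrac eps T i a b = eps ^+ i *: (1%:M + (eps ^+ i * b - a) *: resolvent (eps ^+ i * b)).
Proof.
move=> u.
have e0 : eps ^+ i != 0.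
  by rewrite expf_neq0 // (prim_root_eq0 eps_prim) -lt0n (prim_order_gt0 eps_prim).
rewrite -resolventM // scalemxAr; congr (_ *m _).
have -> : eps ^- i *: T - b%:M = eps ^- i *: (T - (eps ^+ i * b)%:M).
  by rewrite scalerBr scale_scalar_mx mulKf.
by rewrite invmxZ ?invrK // unitmxZ // unitfE invr_eq0.
Qed.

End Conjugation.

(** * The operators R and S *)

Section FsumLinear.
Variables (K : numFieldType) (n : nat) (W : finType).
Variables (tau p : W -> K) (G : W -> 'M[K]_n).

Lemma eq_Fsum X Y : X =1 Y -> Fsum tau p G X = Fsum tau p G Y.
Proof. by move=> XY; apply: eq_bigr => w _; rewrite XY. Qed.

Lemma Fsum_linear c X Y :
  Fsum tau p G (fun w => X w + c *: Y w) = Fsum tau p G X + c *: Fsum tau p G Y.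
Proof.
rewrite /Fsum scaler_sumr -big_split; apply: eq_bigr => w _ /=.
by rewrite mulmxDr scalerDr -scalemxAr !scalerA [c * _]mulrC.
Qed.

End FsumLinear.

Section Operators.
Variables (K : numFieldType) (k m n : nat) (eps : K) (T B : 'M[K]_n).
Variables (lam t : 'I_m -> K).
Local Notation V := (matsum K m n).
Local Notation W := ('I_k * 'I_m)%type.
Hypotheses (eps_prim : k.-primitive_root eps).
Hypotheses (BkE : B ^+ k = 1%:M) (BTE : B *m T = eps *: (T *m B)).
Hypothesis lamt_generic : generic_parameters k eps lam t.
Hypothesis T_unit : forall a, T ^+ k - (lam a ^+ k)%:M \in unitmx.

Definition node (w : W) : K := eps ^+ w.1 * lam w.2.
Definition weight (w : W) : K := eps ^+ w.1 * t w.2.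
Definition node_res (w : W) : 'M[K]_n := resolvent T (node w).
Definition conj_orbit (x : V) (w : W) : 'M[K]_n := conj_by B w.1 (x w.2).

Let k_gt0 : (0 < k)%N := prim_order_gt0 eps_prim.

Lemma eps_neq0 i : eps ^+ i != 0.
Proof. by rewrite expf_neq0 // (prim_root_eq0 eps_prim) -lt0n. Qed.

Lemma node_unit i b : T - (eps ^+ i * lam b)%:M \in unitmx.
Proof.
apply: (@shift_unit _ _ k).
by rewrite exprMn (eps_unity eps_prim) mul1r.
Qed.

Lemma root_order_sub i : (i < k)%N -> eps ^+ (k - i) = eps ^- i.
Proof.
move=> ik; apply: (mulIf (eps_neq0 i)).
by rewrite mulVf ?eps_neq0 // -exprD subnK 1?ltnW // (prim_expr_order eps_prim).
Qed.

(** Genericity compares eps^i lam_b only with an unrotated lam_c. An equality of nodes is therefore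
    multiplied by eps^-j, realized as the exponent k - j + i reduced modulo k. *)
Lemma node_inj : injective node.
Proof.
case: lamt_generic => _ gen [i b] [j c]; rewrite /node /= => E.
have ik : ((k - j + i) %% k < k)%N by rewrite ltn_mod.
have E' : eps ^+ Ordinal ik * lam b - lam c = 0.
  rewrite /= (prim_expr_mod eps_prim) exprD root_order_sub // -mulrA E mulKf ?eps_neq0 //.
  by rewrite subrr.
have := gen (Ordinal ik) c b; rewrite E' eqxx => /contraTF.
case: (b =P c) E' => [-> _|_ _]; last by rewrite orbT => /(_ isT).
rewrite orbF => /(_ isT) /negbFE /=; rewrite -/(dvdn _ _) => /dvdnP[q qE].
congr (_, _); apply/val_inj => /=.
by have := ltn_ord i; have := ltn_ord j; case: q qE => [|[|q]] /=; lia.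
Qed.

Lemma node_sub_mu (u : K) w : lam w.2 ^+ k - u ^+ k != 0 -> node w - u != 0.
Proof. exact: root_sub_neq0. Qed.

(** Summing over the powers of [eps] links the equation for mu, written in k-th powers, with partial
    fractions over the nodes. *)
Lemma sum_weight_inv (u : K) : (forall c, lam c ^+ k - u ^+ k != 0) ->
  \sum_w weight w / (node w - u)
  = k%:R * \sum_c t c * lam c ^+ k.-1 / (lam c ^+ k - u ^+ k).
Proof.
move=> den; rewrite -(pair_bigA _ (fun i c => weight (i, c) / (node (i, c) - u))) /=.
rewrite exchange_big mulr_sumr; apply: eq_bigr => c _ /=.
transitivity (t c * \sum_(i < k) eps ^+ i / (eps ^+ i * lam c - u)).
  by rewrite mulr_sumr; apply: eq_bigr => i _; rewrite /weight /node /=; ring.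
by rewrite (sum_root_inv eps_prim) //; ring.
Qed.

Lemma SopE (l : K) (mu : 'I_m -> K) (x : V) (a : 'I_m) :
  (forall c, lam c ^+ k - mu a ^+ k != 0) ->
  Sop k eps T B lam t l mu x a =
  l *: Fsum weight (fun w => (node w - mu a)^-1) node_res (conj_orbit x).
Proof.
move=> den; rewrite ffunE pair_bigA /= scaler_sumr; apply: eq_bigr => w _.
have nz := @node_sub_mu (mu a) w (den _).
rewrite (TfracE eps_prim) ?node_unit // -/(node w) -/(conj_orbit x w).
have -> : (node w - mu a)^-1%:M + node_res w =
    (node w - mu a)^-1 *: (1%:M + (node w - mu a) *: resolvent T (node w)).
  by rewrite scalerDr scalerA mulVf // scale1r scalemx1.
by rewrite -!scalemxAl !scalerA; congr (_ *: _); rewrite /weight; ring.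
Qed.

(** The multiplier of x_a in [Rop] supplies the missing resolvent term at (0, a) and all the
    subtractions of x_a. The difference term at (0, a) is zero because the orbit of x has the value
    x_a there, whatever the quotient by zero is. *)
Lemma RopE (x : V) (a : 'I_m) : Rop k eps T B lam t x a =
  \sum_(j < k) \sum_b (weight (j, b) *: (node_res (j, b) *m conj_orbit x (j, b))
    + (weight (j, b) / (node (j, b) - lam a)) *: (conj_orbit x (j, b) - x a)).
Proof.
case: lamt_generic => _ gen.
have wE (w : W) : (w.1 != 0 :> nat) || (w.2 != a) = (w != (Ordinal k_gt0, a)).
  by case: w => i b; rewrite -pair_eqE negb_and.
rewrite ffunE [RHS]pair_bigA [X in X *m _](_ : _ = t a *: resolvent T (lam a) -
  (\sum_(w : W | w != (Ordinal k_gt0, a)) weight w / (node w - lam a))%:M); last first.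
  by congr (_ - _%:M); rewrite pair_big_dep; apply: eq_bigl.
rewrite pair_big_dep (eq_bigl _ _ wE) /= [RHS](bigD1 (Ordinal k_gt0, a)) //=.
rewrite [LHS]addrC mulmxBl -addrA.
have w0 : conj_orbit x (Ordinal k_gt0, a) = x a.
  by rewrite /conj_orbit /conj_by /= !expr0 mul1mx mulmx1.
rewrite w0 subrr scaler0 addr0 /weight /node_res /node /= expr0 !mul1r -scalemxAl.
congr (_ + _); rewrite mul_scalar_mx scaler_suml -sumrN -big_split /=.
apply: eq_bigr => -[i b]; rewrite -wE /= => wa.
have nz : node (i, b) - lam a != 0 := gen _ _ _ wa.
rewrite (TfracE eps_prim) ?node_unit // -/(node (i, b)) -/(conj_orbit x (i, b)).
rewrite -scalemxAl mulmxDl mul1mx -scalemxAl !scalerDr !scalerA.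
have -> : t b / (eps ^+ i * lam b - lam a) * eps ^+ i * (node (i, b) - lam a) = eps ^+ i * t b.
  by rewrite -/(node (i, b)); field.
have -> : t b / (eps ^+ i * lam b - lam a) * eps ^+ i = eps ^+ i * t b / (node (i, b) - lam a).
  by rewrite mulrAC [t b * _]mulrC.
by apply/matrixP => i' j'; rewrite ![in LHS]mxE ![in RHS]mxE; ring.
Qed.

Lemma Rop_is_linear : linear (Rop k eps T B lam t).
Proof.
move=> c x y; apply/ffunP => a.
have -> : (c *: Rop k eps T B lam t x + Rop k eps T B lam t y) a
   = c *: Rop k eps T B lam t x a + Rop k eps T B lam t y a by rewrite !ffunE.
rewrite !RopE scaler_sumr -big_split; apply: eq_bigr => j _ /=.
rewrite scaler_sumr -big_split; apply: eq_bigr => b _ /=.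
rewrite /conj_orbit !ffunE linearP /= mulmxDr -scalemxAr.
by apply/matrixP => i' j'; rewrite ![in LHS]mxE ![in RHS]mxE; ring.
Qed.

(** Equivariance: conjugation by B^i rotates all nodes, and the rotated sum over Z/k is the same sum
    with its index shifted. Hence one formula describes R at every node. *)
Lemma Rop_orbit (x : V) (w : W) :
  conj_by B w.1 (Rop k eps T B lam t x w.2)
  = Rsum weight node node_res (conj_orbit x) w.
Proof.
rewrite RopE /Rsum /resolvent_sum -big_split -(pair_bigA _ (fun i b =>
  weight (i, b) *: (node_res (i, b) *m conj_orbit x (i, b)) +
  (weight (i, b) / (node (i, b) - node w)) *: (conj_orbit x (i, b) - conj_orbit x w))) /=.
case: w => i a /=.
pose f j := \sum_b ((eps ^+ j * t b) *: (resolvent T (eps ^+ j * lam b) *m conj_by B j (x b))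
   + (eps ^+ j * t b / (eps ^+ j * lam b - eps ^+ i * lam a)) *:
       (conj_by B j (x b) - conj_by B i (x a))).
have fk j : f (k + j)%N = f j.
  apply: eq_bigr => b _; rewrite conj_byD (conj_by_order eps_prim BkE).
  by rewrite exprD (prim_expr_order eps_prim) mul1r.
rewrite -[RHS](periodic_sum_shift i fk) linear_sum; apply: eq_bigr => j _.
rewrite linear_sum; apply: eq_bigr => b _; rewrite linearD /= linearZ /= linearZ /= linearB /=.
rewrite (conj_byM eps_prim BkE) -conj_byD.
rewrite (conj_by_resolvent eps_prim BkE BTE) ?mulrA -?exprD ?node_unit //.
rewrite -scalemxAl scalerA /weight /node /=; congr (_ *: _ + _ *: _).
  by rewrite exprD; ring.
by rewrite !exprD -!mulrA -mulrBr invfM; move: (_ - _)^-1 => ?; field; rewrite eps_neq0.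
Qed.

(** * Multiplicativity of S and its expansion at l = 0 *)

Section SpectralParameter.
Variables (l : K) (mu : 'I_m -> K).
Hypothesis l_neq0 : l != 0.
Hypothesis mu_den : forall a c, lam c ^+ k - mu a ^+ k != 0.
Hypothesis mu_eq : forall a,
  \sum_c t c * lam c ^+ k.-1 / (lam c ^+ k - mu a ^+ k) = (k%:R * l)^-1.

Lemma sum_weight_mu a : \sum_w weight w / (node w - mu a) = l^-1.
Proof.
rewrite sum_weight_inv // mu_eq invfM mulrA divff ?mul1r //.
exact: (prim_root_natf_neq0 eps_prim).
Qed.

Lemma SopM (x y : V) :
  Sop k eps T B lam t l mu x * Sop k eps T B lam t l mu y
  = Sop k eps T B lam t l mu (x * y + l *: circ k eps T B lam t x y).
Proof.
have XYE (u v : V) w : conj_orbit (u * v) w = conj_orbit u w *m conj_orbit v w.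
  by rewrite /conj_orbit [(u * v) _]ffunE (conj_byM eps_prim BkE).
apply/ffunP => a; rewrite ffunE !SopE // -mulmxE -scalemxAl -scalemxAr scalerA.
rewrite (@Fsum_mul _ _ _ weight node _ node_res node_inj) => [|u w|u w|u w]; first last.
- exact: resolventC (node_unit _ _) (node_unit _ _).
- exact: resolventB (node_unit _ _) (node_unit _ _).
- have := node_sub_mu (mu_den a w.2); have := node_sub_mu (mu_den a u.2).
  by move=> nu nw; field; rewrite nu nw.
(* The prefactor is l^2. By the equation for mu the first term carries l^-1 and becomes S(xy), while
   the second becomes S applied to l times the deformed product. *)
rewrite sum_weight_mu scalerDr scalerA mulfK // -[l * l *: _]scalerA -scalerDr.
congr (_ *: _); rewrite -Fsum_linear; apply: eq_Fsum => w.
have DE c (u v : V) : conj_orbit (u + c *: v) w = conj_orbit u w + c *: conj_orbit v w.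
  by rewrite /conj_orbit !ffunE linearD linearZ.
have BE (u v : V) : conj_orbit (u - v) w = conj_orbit u w - conj_orbit v w.
  by rewrite -scaleN1r DE scaleN1r.
have AE (u v : V) : conj_orbit (u + v) w = conj_orbit u w + conj_orbit v w.
  by rewrite -[v]scale1r DE !scale1r.
have RE (u : V) : conj_orbit (Rop k eps T B lam t u) w = Rsum weight node node_res (conj_orbit u) w.
  exact: Rop_orbit.
rewrite DE BE AE !XYE !RE; congr (_ + _ *: (_ - _)).
by rewrite /Rsum /resolvent_sum; congr (_ + _); apply: eq_bigr => u _; rewrite !XYE.
Qed.

(** The quotient of S(x) - x - l R(x) by l^2, as a function of z = mu_a. By the equation for mu its
    first factor is, up to sign, (lam_a - mu_a) / l; leaving out the index (0, a) keeps it regular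
    at z = lam_a. *)
Definition Sop_remainder (x : V) (a : 'I_m) (z : K) : 'M[K]_n :=
  let off w := w != (Ordinal k_gt0, a) in
  - (t a + (lam a - z) * \sum_(w | off w) weight w / (node w - z)) *:
  \sum_(w | off w) (weight w / ((node w - z) * (node w - lam a))) *: (conj_orbit x w - x a).

Lemma Sop_expansion (x : V) a :
  (Sop k eps T B lam t l mu x - x - l *: Rop k eps T B lam t x) a
  = l ^+ 2 *: Sop_remainder x a (mu a).
Proof.
case: lamt_generic => _ gen.
pose w0 : W := (Ordinal k_gt0, a).
have nw0 : node w0 = lam a by rewrite /node expr0 mul1r.
have tw0 : weight w0 = t a by rewrite /weight expr0 mul1r.
have xw0 : conj_orbit x w0 = x a by rewrite /conj_orbit /conj_by /= !expr0 mul1mx mulmx1.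
have nz w : node w - mu a != 0 by exact: node_sub_mu.
(* Isolating the term at (0, a), the only one singular at mu_a = lam_a, in the equation for mu
   exhibits a factor l in lam_a - mu_a. *)
have muE : lam a - mu a =
    l * (t a + (lam a - mu a) * \sum_(w | w != w0) weight w / (node w - mu a)).
  have := sum_weight_mu a; rewrite (bigD1 w0) //= nw0 tw0.
  set s := \sum_(w | _) _ => E.
  have nz0 : lam a - mu a != 0 by rewrite -nw0.
  have -> : s = l^-1 - t a / (lam a - mu a) by rewrite -E addrAC subrr add0r.
  by field; rewrite nz0.
(* Writing x_a as l times its multiple by the sum that equals l^-1 gives S(x) - x the shape of l
   R(x) with mu_a in place of lam_a in the denominators. *)
have SE : Sop k eps T B lam t l mu x a = x a + l *: \sum_w
    (weight w *: (node_res w *m conj_orbit x w)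
     + (weight w / (node w - mu a)) *: (conj_orbit x w - x a)).
  have xE : x a = l *: \sum_w (weight w / (node w - mu a)) *: x a.
    by rewrite -scaler_suml sum_weight_mu scalerA divff // scale1r.
  rewrite SopE // [X in _ = X + _]xE -scalerDr.
  congr (_ *: _); rewrite -big_split; apply: eq_bigr => w _ /=.
  rewrite mulmxDl mul_scalar_mx scalerDr scalerA.
  by apply/matrixP => i j; rewrite ![in LHS]mxE ![in RHS]mxE; ring.
have -> : (Sop k eps T B lam t l mu x - x - l *: Rop k eps T B lam t x) a
   = Sop k eps T B lam t l mu x a - x a - l *: Rop k eps T B lam t x a by rewrite !ffunE.
have RE : Rop k eps T B lam t x a = \sum_w
    (weight w *: (node_res w *m conj_orbit x w)
     + (weight w / (node w - lam a)) *: (conj_orbit x w - x a)).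
  by rewrite RopE pair_bigA; apply: eq_bigr => -[].
rewrite SE RE [x a + _]addrC addrK -scalerBr -sumrB /= (bigD1 w0) //=.
rewrite xw0 subrr !scaler0 !addr0 subrr add0r.
rewrite /Sop_remainder /= -/w0 scalerA mulrN expr2 -mulrA -muE -mulrN -scalerA; congr (_ *: _).
rewrite scaler_sumr; apply: eq_bigr => -[i b] /= w1.
have nzl : node (i, b) - lam a != 0.
  by apply: gen; move: w1; rewrite -pair_eqE negb_and.
have coefE : weight (i, b) / (node (i, b) - mu a) = weight (i, b) / (node (i, b) - lam a)
    + - (lam a - mu a) * (weight (i, b) / ((node (i, b) - mu a) * (node (i, b) - lam a))).
  by have := nz (i, b) => nzm; field; rewrite nzm nzl.
rewrite coefE.
by apply/matrixP => i' j'; rewrite ![in LHS]mxE ![in RHS]mxE; ring.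
Qed.

End SpectralParameter.

End Operators.

(** * The inverse of S *)

Section TwistedOperators.
Variables (K : numFieldType) (k m n : nat) (B : 'M[K]_n).
Local Notation V := (matsum K m n).
Variable M : nat -> 'I_m -> 'I_m -> 'M[K]_n.

(** The common shape of S and of its inverse, so that linearity and the adjoint are treated once. *)
Definition twisted_op (y : V) : V :=
  [ffun a => \sum_(i < k) \sum_b M i a b *m conj_by B i (y b)].

Fact twisted_op_is_linear : linear twisted_op.
Proof.
move=> c x y; apply/ffunP => a; rewrite !ffunE scaler_sumr -big_split.
apply: eq_bigr => i _ /=; rewrite scaler_sumr -big_split; apply: eq_bigr => b _ /=.
by rewrite !ffunE linearD linearZ mulmxDr scalemxAr.
Qed.

HB.instance Definition _ :=
  GRing.isLinear.Build K V V _ twisted_op twisted_op_is_linear.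

Lemma adjoint_twisted_op (x : V) : adjoint twisted_op x =
  [ffun b => \sum_(i < k) \sum_a B ^+ i *m x a *m M i a b *m invmx B ^+ i].
Proof.
symmetry; move: x.
apply: (@adjoint_unique _ _ _ _ (fun x : V => [ffun b => \sum_(i < k) \sum_a
  B ^+ i *m x a *m M i a b *m invmx B ^+ i])) => y x.
transitivity (\sum_a \sum_b \sum_(i < k) \tr (M i a b *m conj_by B i (y b) *m x a)).
  apply: eq_bigr => a _; rewrite ffunE mulmx_suml (raddf_sum (@mxtrace _ _)) [RHS]exchange_big /=.
  apply: eq_bigr => i _.
  by rewrite mulmx_suml (raddf_sum (@mxtrace _ _)).
rewrite exchange_big; apply: eq_bigr => b _; rewrite ffunE mulmx_sumr.
rewrite (raddf_sum (@mxtrace _ _)) [LHS]exchange_big /=.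
apply: eq_bigr => i _; rewrite mulmx_sumr (raddf_sum (@mxtrace _ _)); apply: eq_bigr => a _ /=.
by rewrite /conj_by -!mulmxA mxtrace_mulC -!mulmxA mxtrace_mulC -!mulmxA.
Qed.

End TwistedOperators.

(** In finite dimension a linear map with a right inverse is surjective, hence injective by
    rank-nullity. *)
Lemma cancel_linear_sym (K : fieldType) (V : vectType K) (f : {linear V -> V}) (g : V -> V) :
  cancel g f -> cancel f g.
Proof.
move=> gK; pose F := linfun f.
have FE x : F x = f x by rewrite lfunE.
have img : limg F = fullv.
  apply/eqP; rewrite eqEsubv subvf; apply/subvP => x _.
  by rewrite -(gK x) -FE memv_img ?memvf.
have := limg_ker_dim F fullv; rewrite img capfv -{2}[\dim fullv]add0n => /addIn/eqP.
rewrite dimv_eq0 => /lker0P Finj x.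
by apply: Finj; rewrite !FE gK.
Qed.

Section Inverse.
Variables (K : numFieldType) (k m n : nat) (eps : K) (T B : 'M[K]_n).
Variables (lam t : 'I_m -> K).
Local Notation V := (matsum K m n).
Hypotheses (eps_prim : k.-primitive_root eps).
Hypotheses (BkE : B ^+ k = 1%:M) (BTE : B *m T = eps *: (T *m B)).
Hypothesis lamt_generic : generic_parameters k eps lam t.
Hypothesis T_unit : forall a, T ^+ k - (lam a ^+ k)%:M \in unitmx.
Let k_gt0 : (0 < k)%N := prim_order_gt0 eps_prim.

(** For k = 1 the exponent is 0; for k > 1 genericity with i = 1 and equal indices says that (eps -
    1) lam_b is nonzero. *)
Lemma lam_pow_neq0 b : lam b ^+ k.-1 != 0.
Proof.
have [k1|k1] := leqP k 1; first by rewrite (_ : k.-1 = 0)%N ?oner_eq0 //; lia.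
case: lamt_generic => _ /(_ (Ordinal k1) b b isT).
by apply: contra_neq => /eqP; rewrite expf_eq0 => /andP[_ /eqP->]; rewrite mulr0 subrr.
Qed.

(** Nonzero numbers with equal k-th powers differ by a power of [eps], which genericity excludes for
    distinct indices. *)
Lemma lam_pow_inj : injective (fun b => lam b ^+ k).
Proof.
move=> b c; have [-> //|bc] := eqVneq b c => E.
have [c0|c0] := eqVneq (lam c) 0.
  case: lamt_generic => _ /(_ (Ordinal k_gt0) c b).
  move: E; rewrite c0 expr0n (gtn_eqF k_gt0) => /eqP; rewrite expf_eq0 => /andP[_ /eqP ->].
  by rewrite bc orbT mulr0 subrr eqxx => /(_ isT).
have [i iE] : {i : 'I_k | lam c / lam b = eps ^+ i}.
  apply: (prim_rootP eps_prim); rewrite expr_div_n E divff // expf_neq0 //.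
case: lamt_generic => _ /(_ i c b).
rewrite -iE divfK ?subrr ?eqxx ?bc ?orbT => [/(_ isT) //|].
apply: contra_neq c0 => b0; apply/eqP; have /eqP := E.
by rewrite b0 expr0n (gtn_eqF k_gt0) eq_sym expf_eq0 => /andP[].
Qed.

Variables (l : K) (mu : 'I_m -> K).
Hypothesis l_neq0 : l != 0.
Hypothesis mu_den : forall a c, lam c ^+ k - mu a ^+ k != 0.
Hypothesis mu_def : Lop_defined k T mu.

(** The part of [Lcoef] independent of i, separated so that the sums over roots of unity involve
    only simple fractions. *)
Definition cauchy_coef (b c : 'I_m) : K :=
  \prod_s ((lam b ^+ k - mu s ^+ k) * (lam s ^+ k - mu c ^+ k)) /
  (k%:R ^+ 2 * lam b ^+ k.-1 * mu c ^+ k.-1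
   * (\prod_(s < m | s != b) (lam b ^+ k - lam s ^+ k))
   * (\prod_(s < m | s != c) (mu c ^+ k - mu s ^+ k))).

Lemma LcoefE i b c : Lcoef k eps lam mu i b c = cauchy_coef b c / (lam b - eps ^+ i * mu c).
Proof. by rewrite /Lcoef /cauchy_coef -[RHS]mulrA -invfM; congr (_ / _); ring. Qed.

(** The sum over i leaves a Cauchy matrix in k-th powers, whose inversion forces a = c. The
    remaining factor [D] is then a character sum, which forces k to divide r. *)
Lemma cauchy_coef_orthogonality r a c :
  (-1) ^+ m.-1 * (\sum_b cauchy_coef b c *
    \sum_(i < k) eps ^+ i / ((eps ^+ i * lam b - mu a) * (eps ^+ i * lam b - eps ^+ r * mu c)))
  = ((k %| r)%N && (a == c))%:R.
Proof.
have pow_r : (eps ^+ r * mu c) ^+ k = mu c ^+ k by rewrite exprMn (eps_unity eps_prim) mul1r.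
have k0 : k%:R != 0 :> K := prim_root_natf_neq0 eps_prim.
case: mu_def => mu_inj /(_ c)[mu0 _].
pose D := \sum_(j < k) mu a ^+ (k.-1 - j) * (eps ^+ r * mu c) ^+ j.
pose P := \prod_s (lam s ^+ k - mu c ^+ k).
pose Q := \prod_(s < m | s != c) (mu c ^+ k - mu s ^+ k).
have Q0 : Q != 0.
  by apply/prodf_neq0 => s sc; rewrite subr_eq0; apply: contra_neq sc => /mu_inj.
have P0 : P != 0 by apply/prodf_neq0 => s _.
have -> : \sum_b cauchy_coef b c * \sum_(i < k)
      eps ^+ i / ((eps ^+ i * lam b - mu a) * (eps ^+ i * lam b - eps ^+ r * mu c))
  = D * P / (k%:R * mu c ^+ k.-1 * Q) * \sum_b (\prod_s (lam b ^+ k - mu s ^+ k)) /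
    ((lam b ^+ k - mu a ^+ k) * (lam b ^+ k - mu c ^+ k)
     * \prod_(s < m | s != b) (lam b ^+ k - lam s ^+ k)).
  rewrite mulr_sumr; apply: eq_bigr => b _.
  rewrite (sum_root_inv2 eps_prim) ?pow_r // -/D /cauchy_coef big_split /= -/P -/Q.
  have b0 := lam_pow_neq0 b.
  set Z := \prod_(s < m | _) (lam b ^+ k - lam s ^+ k).
  have Z0 : Z != 0.
    by apply/prodf_neq0 => s sb; rewrite subr_eq0; apply: contra_neq sb => /lam_pow_inj.
  by field; rewrite Q0 Z0 k0 b0 mu0 !mu_den.
rewrite (@cauchy_orthogonality _ _ (fun b => lam b ^+ k) (fun b => mu b ^+ k)) //; last first.
  exact: lam_pow_inj.
have [ac|ac] := eqVneq a c; last by rewrite oppr0 mul0r !mulr0 andbF.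
rewrite ac andbT.
(* Reversing m differences gives (-1)^m, which the minus sign of the Cauchy relation turns into
   (-1)^(m-1), cancelling the sign in front. *)
have -> : \prod_s (mu c ^+ k - lam s ^+ k) = (-1) ^+ m * P.
  under eq_bigr do rewrite -opprB.
  by rewrite prodrN card_ord.
have -> : D = mu c ^+ k.-1 * (k %| r)%:R * k%:R.
  have -> : mu c ^+ k.-1 * (k %| r)%:R * k%:R = mu c ^+ k.-1 * \sum_(i < k) eps ^+ (i * r).
    rewrite (sum_exp_prim_root eps_prim); case: ifP => _; first by rewrite mulr1.
    by rewrite !mulr0 mul0r.
  rewrite mulr_sumr /D ac; apply: eq_bigr => j _.
  rewrite exprMn -exprM mulrCA [(r * j)%N]mulnC -exprD mulrC subnK //.
  by have := ltn_ord j; lia.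
have -> : (-1) ^+ m = - (-1) ^+ m.-1 :> K.
  by rewrite -[in LHS](prednK (leq_ltn_trans (leq0n c) (ltn_ord c))) exprS mulN1r.
rewrite -/Q /=; move: (_ ^+ _) (signr_eq0 K m.-1) (nat_of_bool _)%:R => s s0 d.
by field; rewrite Q0 P0 mu0 k0 s0.
Qed.

(** Read off from [Lop] by undoing the adjoint, which transposes the component indices and moves the
    conjugation by [B] to the other side of the fraction. *)
Definition Sop_inv : V -> V :=
  twisted_op k B (fun i b a => ((-1) ^+ m.-1 * Lcoef k eps lam mu i b a / (t b * l)) *:
    Tfrac eps T i (lam b) (mu a)).

Lemma Sop_twisted : Sop k eps T B lam t l mu =
  twisted_op k B (fun i a b => (l * t b / (eps ^+ i * lam b - mu a)) *:
    Tfrac eps T i (mu a) (lam b)).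
Proof.
apply/funext => x; apply/ffunP => a; rewrite !ffunE; apply: eq_bigr => i _.
by apply: eq_bigr => b _; rewrite scalemxAl.
Qed.

Lemma adjoint_Sop_inv x : adjoint Sop_inv x = Lop k eps T B lam t l mu x.
Proof.
rewrite adjoint_twisted_op; apply/ffunP => a; rewrite !ffunE scaler_sumr.
apply: eq_bigr => i _; rewrite scaler_sumr; apply: eq_bigr => b _.
by rewrite -!scalemxAr -!scalemxAl !scalerA; congr (_ *: _); ring.
Qed.

(** Conjugation by B^i replaces [T] by eps^-i T in the second fraction, so its numerator cancels the
    denominator of the first and lam_b disappears. *)
Lemma Tfrac_compose i j a b c :
  Tfrac eps T i (mu a) (lam b) *m conj_by B i (Tfrac eps T j (lam b) (mu c))
  = Tfrac eps T (i + j) (mu a) (mu c).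
Proof.
case: mu_def => _ /(_ c)[_ Tmu].
have un i' z : T ^+ k - (z ^+ k)%:M \in unitmx -> eps ^- i' *: T - z%:M \in unitmx.
  move=> u; have -> : eps ^- i' *: T - z%:M = eps ^- i' *: (T - (eps ^+ i' * z)%:M).
    by rewrite scalerBr scale_scalar_mx mulKf // (eps_neq0 eps_prim).
  rewrite unitmxZ ?unitfE ?invr_eq0 ?(eps_neq0 eps_prim) //.
  by apply: (@shift_unit _ _ k); rewrite exprMn (eps_unity eps_prim) mul1r.
have cE j' z : conj_by B i (eps ^- j' *: T - z%:M) = eps ^- (i + j') *: T - z%:M.
  rewrite linearB linearZ /= (conj_by_twist eps_prim BkE BTE) scalerA -invfM -exprD addnC.
  by rewrite -[z%:M]scalemx1 linearZ /= (conj_by1mx eps_prim BkE).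
rewrite /Tfrac (conj_byM eps_prim BkE) -mulmxA; congr (_ *m _).
have := cE 0 (lam b); rewrite expr0 invr1 scale1r addn0 => ->.
rewrite mulmxA mulVmx ?mul1mx ?un //.
have uc : conj_by B i (eps ^- j *: T - (mu c)%:M) \in unitmx by rewrite cE un.
rewrite -cE -[LHS]mulmx1 -(mulmxV uc) mulmxA -(conj_byM eps_prim BkE) mulVmx ?un //.
by rewrite (conj_by1mx eps_prim BkE) mul1mx.
Qed.

Lemma Sop_invK : cancel Sop_inv (Sop k eps T B lam t l mu).
Proof.
case: lamt_generic => t0 _ y; rewrite Sop_twisted; apply/ffunP => a; rewrite ffunE.
pose s (i r : nat) b c := cauchy_coef b c *
  (eps ^+ i / ((eps ^+ i * lam b - mu a) * (eps ^+ i * lam b - eps ^+ r * mu c))).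
(* Here r stands for the total power i + j of the two conjugations; periodicity in r allows r to
   replace j as summation index. *)
pose g (i r : nat) := \sum_b \sum_c ((-1) ^+ m.-1 * s i r b c) *:
  (Tfrac eps T r (mu a) (mu c) *m conj_by B r (y c)).
have gk i r : g i (k + r)%N = g i r.
  rewrite /g /s /Tfrac; apply: eq_bigr => b _; apply: eq_bigr => c _.
  by rewrite conj_byD (conj_by_order eps_prim BkE) !exprD (prim_expr_order eps_prim) !mul1r.
transitivity (\sum_(i < k) \sum_(r < k) g i r).
  apply: eq_bigr => i _; rewrite -(periodic_sum_shift i (gk i)) exchange_big.
  apply: eq_bigr => b _; rewrite ffunE linear_sum mulmx_sumr; apply: eq_bigr => j _.
  rewrite linear_sum mulmx_sumr; apply: eq_bigr => c _.
  rewrite -!scalemxAl linearZ /= (conj_byM eps_prim BkE) -conj_byD -scalemxAr scalerA.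
  rewrite mulmxA Tfrac_compose LcoefE /s; congr (_ *: _).
  have e0 := eps_neq0 eps_prim i.
  (* Pulling out eps^i makes both denominators linear in eps^i lam_b and supplies the numerator
     needed for the root sums. *)
  have -> : eps ^+ i * lam b - eps ^+ (i + j) * mu c = eps ^+ i * (lam b - eps ^+ j * mu c).
    by rewrite exprD; ring.
  rewrite !invfM; move: (_ - _)^-1 (_ - _)^-1 => u v.
  by field; rewrite l_neq0 t0 e0.
have sum_g r : \sum_(i < k) g i r = \sum_c ((k %| r)%N && (a == c))%:R *:
    (Tfrac eps T r (mu a) (mu c) *m conj_by B r (y c)).
  rewrite /g exchange_big exchange_big /= ; under eq_bigr do rewrite exchange_big.
  rewrite exchange_big; apply: eq_bigr => c _ /=.
  rewrite -(cauchy_coef_orthogonality r a c) mulr_sumr scaler_suml exchange_big.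
  apply: eq_bigr => b _ /=; rewrite !mulr_sumr scaler_suml.
  by apply: eq_bigr => i _.
(* Only r = 0 and c = a survive, where the fraction of [T] is the identity. *)
rewrite exchange_big (bigD1 (Ordinal k_gt0)) //= [X in _ + X]big1 ?addr0 => [|r r0].
  rewrite sum_g (bigD1 a) //= [X in _ + X]big1 ?addr0 => [|c ca].
    rewrite dvdn0 eqxx scale1r /conj_by !expr0 mul1mx mulmx1.
    rewrite /Tfrac expr0 invr1 scale1r mulmxV ?mul1mx //.
    by apply: (@shift_unit _ _ k); case: mu_def => _ /(_ a)[].
  by rewrite eq_sym (negbTE ca) andbF scale0r.
rewrite sum_g big1 // => c _.
by rewrite gtnNdvd ?scale0r // lt0n; apply: contra_neq r0 => r0; apply/val_inj.
Qed.

Lemma SopK : cancel (Sop k eps T B lam t l mu) Sop_inv.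
Proof. by have := Sop_invK; rewrite Sop_twisted => /cancel_linear_sym. Qed.

End Inverse.

(** * The Lax equation *)

Section LinearLaxEquation.
Variables (K : numFieldType) (m n : nat).
Local Notation V := (matsum K m n).

Lemma ffunMmxE (x y : V) a : (x * y) a = x a *m y a.
Proof. by rewrite ffunE. Qed.

Lemma trformC (x y : V) : trform x y = trform y x.
Proof. by apply: eq_bigr => a _; rewrite mxtrace_mulC. Qed.

Lemma trformMA (x y z : V) : trform (x * y) z = trform x (y * z).
Proof. by apply: eq_bigr => a _; rewrite !ffunMmxE mulmxA. Qed.

Fact trform_is_linear (z : V) : linear_for *%R (fun x : V => trform x z).
Proof.
move=> c x y; rewrite /trform mulr_sumr -big_split; apply: eq_bigr => a _ /=.
by rewrite !ffunE mulmxDl mxtraceD -scalemxAl mxtraceZ.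
Qed.

Lemma trformDl (x y z : V) : trform (x + y) z = trform x z + trform y z.
Proof. by rewrite -[x]scale1r trform_is_linear mul1r scale1r. Qed.

Lemma trformZl c (x z : V) : trform (c *: x) z = c * trform x z.
Proof.
have t0 : trform 0 z = 0.
  by rewrite /trform big1 // => a _; rewrite ffunE mul0mx mxtrace0.
by rewrite -[c *: x]addr0 trform_is_linear t0 addr0.
Qed.

Lemma trformBl (x y z : V) : trform (x - y) z = trform x z - trform y z.
Proof. by rewrite -scaleN1r trformDl trformZl mulN1r. Qed.

Lemma trform_comm (x y z : V) : trform (comm x y) z = trform x (comm y z).
Proof.
rewrite /comm trformBl [RHS]trformC trformBl; congr (_ - _).
  by rewrite trformMA trformC.
by rewrite trformC trformMA.
Qed.

Lemma trform_inj (y y' : V) : (forall x, trform x y = trform x y') -> y = y'.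
Proof.
move=> yy'; apply/ffunP => a; apply/matrixP => i j.
by rewrite -!trform_unitvec.
Qed.

Variables (Q : {linear V -> V}) (S : V -> V) (Sinv : {linear V -> V}) (l : K).
Hypothesis l_neq0 : l != 0.
Hypotheses (SK : cancel S Sinv) (SinvK : cancel Sinv S).
Hypothesis SM : forall x y,
  S x * S y = S (x * y + l *: (Q x * y + x * Q y - Q (x * y))).

(** Antisymmetrizing [SM] shows that S carries the commutator plus l times its deformation to the
    commutator; pairing with S(y) transfers this to the adjoint of the inverse. *)
Lemma adjoint_inv_comm (x : V) :
  adjoint Sinv (comm (Q x + adjoint Q x) x)
  = comm (l^-1 *: S x) (adjoint Sinv x).
Proof.
apply: trform_inj => z; rewrite -(SinvK z); move: (Sinv z) => y.
have SL u v : trform (S u) (adjoint Sinv v) = trform u v by rewrite -adjointP SK.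
(* Invariance of the trace form kills commutators with x paired against x. This removes the term of
   order l^-1 and the terms containing Q(y). *)
have c0 u : trform (comm u x) x = 0.
  rewrite trform_comm /comm subrr trformC /trform big1 // => a _.
  by rewrite ffunE mul0mx mxtrace0.
rewrite SL -[RHS]trform_comm.
have -> : comm (S y) (l^-1 *: S x) = l^-1 *: (S y * S x - S x * S y).
  by apply/ffunP => a; rewrite !ffunE -!mulmxE -scalemxAr -scalemxAl scalerBr.
have E1 : trform (y * x) x = trform (x * y) x by apply/eqP; rewrite -subr_eq0 -trformBl c0.
have E2 : trform (Q y * x) x = trform (x * Q y) x by apply/eqP; rewrite -subr_eq0 -trformBl c0.
have -> : trform y (comm (Q x + adjoint Q x) x) =
    trform (y * Q x) x - trform (Q x * y) x - (trform (Q (y * x)) x - trform (Q (x * y)) x).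
  have -> : comm (Q x + adjoint Q x) x = comm (Q x) x - comm x (adjoint Q x).
    by rewrite /comm mulrDl mulrDr !opprD opprK addrACA; congr (_ + _); rewrite addrC.
  rewrite trformC trformBl -!(trformC y) -!trform_comm -adjointP.
  by rewrite linearB /= !trformBl.
rewrite trformZl !SM trformBl !SL !(trformBl, trformDl, trformZl) E1 E2.
by field.
Qed.

Lemma is_derive_sum_fun (I : Type) (r : seq I) (h : I -> K -> K) (dh : I -> K) (s : K) :
  (forall i, is_derive s (1 : K) (h i) (dh i)) ->
  is_derive s (1 : K) (fun u => \sum_(i <- r) h i u) (\sum_(i <- r) dh i).
Proof.
move=> hd; elim: r => [|i r IH].
  rewrite big_nil; under eq_fun do rewrite big_nil.
  exact: is_derive_cst.
by rewrite big_cons; under eq_fun do rewrite big_cons; exact: is_deriveD.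
Qed.

(** The adjoint of the inverse is linear and does not depend on time, so differentiating it along x
    applies it to the velocity; each entry is a finite combination of entries of x. *)
Lemma Lax_representation_adjoint_inv :
  Lax_representation (fun x => comm (Q x + adjoint Q x) x)
    (fun x => l^-1 *: S x) (adjoint Sinv).
Proof.
move=> D x dx s Ds a i j; rewrite -adjoint_inv_comm.
have trE (w v : V) : trform w v = \sum_b \sum_p \sum_q w b p q * v b q p.
  by apply: eq_bigr => b _; apply: eq_bigr => p _; rewrite mxE.
rewrite !ffunE !mxE trE.
under eq_fun do rewrite ffunE mxE trE.
do 3!(apply: is_derive_sum_fun => ?).
exact: is_deriveZ (dx _ Ds _ _ _).
Qed.

End LinearLaxEquation.

(** * Behaviour near zero *)

Section Limits.
Variables (K : numFieldType) (X : Type) (F : set_system X).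
Hypothesis FF : Filter F.

Lemma cvg_finsum (I : finType) (P : pred I) (h : I -> X -> K) (a : I -> K) :
  (forall i, P i -> h i z @[z --> F] --> a i) ->
  \sum_(i | P i) h i z @[z --> F] --> \sum_(i | P i) a i.
Proof. by move=> ha; apply: cvg_big => //; exact: add_continuous. Qed.

Lemma cvg_finprod (I : finType) (h : I -> X -> K) (a : I -> K) :
  (forall i, h i z @[z --> F] --> a i) ->
  \prod_i h i z @[z --> F] --> \prod_i a i.
Proof. by move=> ha; apply: cvg_big => //; exact: mul_continuous. Qed.

Lemma cvg_exprn (f : X -> K) (a : K) k : f z @[z --> F] --> a -> f z ^+ k @[z --> F] --> a ^+ k.
Proof.
move=> fa; elim: k => [|k IH]; first exact: cvg_cst.
by under eq_fun do rewrite exprS; rewrite exprS; exact: cvgM.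
Qed.

Lemma cvg_det n (A : X -> 'M[K]_n) (A0 : 'M[K]_n) :
  (forall i j, A z i j @[z --> F] --> A0 i j) -> \det (A z) @[z --> F] --> \det A0.
Proof.
move=> hA; apply: cvg_finsum => s _; apply: cvgM; first exact: cvg_cst.
exact: cvg_finprod.
Qed.

End Limits.

Section Perturbation.
Variables (K : numFieldType) (k m n : nat) (eps : K) (T B : 'M[K]_n).
Variables (lam t : 'I_m -> K).
Local Notation V := (matsum K m n).
Hypotheses (eps_prim : k.-primitive_root eps).
Hypothesis lamt_generic : generic_parameters k eps lam t.
Hypothesis T_unit : forall a, T ^+ k - (lam a ^+ k)%:M \in unitmx.
Variables (X : Type) (F : set_system X) (mu : X -> 'I_m -> K).
Hypothesis FF : Filter F.
Hypothesis mu_cvg : forall a, mu z a @[z --> F] --> lam a.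

(** The index (0, a) is absent, so by genericity all denominators have nonzero limits. *)
Lemma cvg_Sop_remainder (x : V) a i j :
  Sop_remainder B lam t eps_prim x a (mu z a) i j @[z --> F] -->
  Sop_remainder B lam t eps_prim x a (lam a) i j.
Proof.
case: lamt_generic => _ gen.
have nz (w : 'I_k * 'I_m) : w != (Ordinal (prim_order_gt0 eps_prim), a) ->
    node eps lam w - lam a != 0.
  by case: w => i' b; rewrite -pair_eqE negb_and; exact: gen.
rewrite /Sop_remainder; under eq_fun do rewrite mxE summxE; rewrite mxE summxE.
have cvg_sub (w : 'I_k * 'I_m) : node eps lam w - mu z a @[z --> F] --> node eps lam w - lam a.
  by apply: cvgB; [exact: cvg_cst | exact: mu_cvg].
apply: cvgM.
  apply: cvgN; apply: cvgD; first exact: cvg_cst.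
  apply: cvgM; first by apply: cvgB; [exact: cvg_cst | exact: mu_cvg].
  apply: cvg_finsum => w wa; apply: cvgM; first exact: cvg_cst.
  by apply: cvgV => //; exact: nz.
apply: cvg_finsum => w wa; under eq_fun do rewrite mxE; rewrite mxE.
apply: cvgM; last exact: cvg_cst.
apply: cvgM; first exact: cvg_cst.
apply: cvgV; first by rewrite mulf_neq0 ?nz.
by apply: cvgM => //; exact: cvg_cst.
Qed.

(** Finitely many nonvanishing conditions, invertibility being expressed by a determinant; each
    holds in the limit mu = lam and so persists nearby. *)
Lemma Lop_defined_near : \forall z \near F, Lop_defined k T (mu z).
Proof.
have mu_powB b c : b != c -> \forall z \near F, mu z b ^+ k - mu z c ^+ k != 0.
  move=> bc; apply: (@cvgr_neq0 _ _ _ _ _ _ (lam b ^+ k - lam c ^+ k)).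
    by apply: cvgB; exact: cvg_exprn.
  rewrite subr_eq0; apply: contra_neq bc; exact: lam_pow_inj eps_prim lamt_generic _ _.
have mu_pow b : \forall z \near F, mu z b ^+ k.-1 != 0.
  apply: (@cvgr_neq0 _ _ _ _ _ _ (lam b ^+ k.-1)); first exact: cvg_exprn.
  exact: lam_pow_neq0 eps_prim lamt_generic _.
have mu_unit b : \forall z \near F, \det (T ^+ k - (mu z b ^+ k)%:M) != 0.
  apply: (@cvgr_neq0 _ _ _ _ _ _ (\det (T ^+ k - (lam b ^+ k)%:M))).
    apply: cvg_det => i j; under eq_fun do rewrite !mxE; rewrite !mxE.
    apply: cvgB; first exact: cvg_cst.
    by case: (i == j); [exact: cvg_exprn | exact: cvg_cst].
  by rewrite -unitfE -unitmxE.
have mu_inj b c : \forall z \near F, mu z b ^+ k = mu z c ^+ k -> b = c.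
  have [->|bc] := eqVneq b c; first exact: nearW.
  by apply: filterS (mu_powB _ _ bc) => z /eqP nz E; case: nz; rewrite E subrr.
apply: filterS3 (filter_forall _ (fun b => filter_forall _ (mu_inj b)))
  (filter_forall _ mu_pow) (filter_forall _ mu_unit) => z inj nz unit.
split=> [b c /inj //|b]; split; first exact: nz.
by rewrite unitmxE unitfE.
Qed.

End Perturbation.

(** * The complex exponential and primitive roots of unity *)

Section RootOfUnity.
Variable R : realType.

Lemma expiD (x y : R) : expi (x + y) = expi x * expi y.
Proof. by rewrite /expi cosD sinD; simpc; congr (_ +i* _)%C; ring. Qed.

Lemma expi0 : expi (0 : R) = 1.
Proof. by rewrite /expi cos0 sin0. Qed.

Lemma expiX (x : R) j : expi x ^+ j = expi (x *+ j).
Proof. by elim: j => [|j IH]; rewrite ?expi0 // exprS IH mulrS expiD. Qed.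

Lemma expi_primitive_root k : (0 < k)%N -> k.-primitive_root (expi (2 * pi / k%:R : R)).
Proof.
move=> k0; have kR : k%:R != 0 :> R by rewrite pnatr_eq0 -lt0n.
have zk : expi (2 * pi / k%:R : R) ^+ k = 1.
  by rewrite expiX -[X in expi X]mulr_natr divfK // mulr_natl /expi cos2pi sin2pi.
apply/andP; split=> //; apply/forallP => i; rewrite unity_rootE.
have [ik|ik] := eqVneq i.+1 k; first by rewrite ik zk eqxx.
apply/eqP/negbTE; rewrite expiX.
have ltik : (i.+1 < k)%N by rewrite ltn_neqAle ik ltn_ord.
have -> : 2 * pi / k%:R *+ i.+1 = (pi * (i.+1%:R / k%:R)) *+ 2 :> R.
  by rewrite -[LHS]mulr_natr -[RHS]mulr_natr; field.
(* With the angle halved, a value 1 would make the exponential of the half angle 1 or -1, hence its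
   sine zero; but the half angle lies strictly between 0 and pi. *)
rewrite -expiX -subr_eq0 subr_sqr_1 mulf_eq0 subr_eq0 addr_eq0.
have : sin (pi * (i.+1%:R / k%:R)) != 0 :> R.
  apply/lt0r_neq0/sin_gt0_pi; rewrite mulr_gt0 ?pi_gt0 ?divr_gt0 ?ltr0n //=.
  by rewrite gtr_pMr ?pi_gt0 // ltr_pdivrMr ?ltr0n // mul1r ltr_nat.
apply: contra => /orP[] /eqP; rewrite /expi => /(congr1 (@complex.Im R)) /= ->; rewrite ?oppr0 //.
Qed.

End RootOfUnity.

Theorem proposition3 (R : realType) (k m n : nat)
  (k_gt0 : (0 < k)%N) (m_gt0 : (0 < m)%N) (n_gt0 : (0 < n)%N)
  (eps : Cplx R) (epsE : eps = expi (2 * pi / k%:R))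
  (T B : 'M[Cplx R]_n)
  (BkE : B ^+ k = 1%:M) (BTE : B *m T = eps *: (T *m B))
  (lam t : 'I_m -> Cplx R)
  (lamt_generic : generic_parameters k eps lam t)
  (T_unit : forall a, (T ^+ k - (lam a ^+ k)%:M) \in unitmx)
  (U : set (Cplx R)) (U_open : open U) (U0 : U 0)
  (mu : Cplx R -> 'I_m -> Cplx R)
  (mu_algebraic : forall a, algebraic_function U (fun l => mu l a))
  (mu0 : forall a, mu 0 a = lam a)
  (mu_den : forall l, U l -> l != 0 ->
     forall a c, lam c ^+ k - mu l a ^+ k != 0)
  (mu_eq : forall l, U l -> l != 0 -> forall a,
     \sum_(c < m) t c * lam c ^+ k.-1 / (lam c ^+ k - mu l a ^+ k)
     = (k%:R * l)^-1) :
  let Rlam := Rop k eps T B lam t in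
  let Slam := fun l => Sop k eps T B lam t l (mu l) in
  let Llam := fun l => Lop k eps T B lam t l (mu l) in
  [/\
      (* (a) *)
      (forall x a i j,
         (fun l => (Slam l x - x - l *: Rlam x) a i j) =O_ (0^') (fun l => l ^+ 2))
      /\
      (forall l, U l -> l != 0 -> forall x y,
         Slam l x * Slam l y = Slam l (x * y + l *: circ k eps T B lam t x y)),
      (* (b) is about the l at which its formula makes sense; these include
         all l != 0 close to 0 *)
      (\forall l \near 0^', Lop_defined k T (mu l))
    & (* (b) *)
      forall l, U l -> l != 0 -> Lop_defined k T (mu l) ->
        (exists Sinv : matsum (Cplx R) m n -> matsum (Cplx R) m n,
           [/\ cancel (Slam l) Sinv, cancel Sinv (Slam l)
             & forall x, adjoint Sinv x = Llam l x])
        /\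
        Lax_representation (fun x => comm (Rlam x + adjoint Rlam x) x)
          (fun x => l^-1 *: Slam l x) (Llam l)].
Proof.
move=> Rlam Slam Llam.
have eps_prim : k.-primitive_root eps by rewrite epsE; exact: expi_primitive_root.
have mu_cvg a : mu z a @[z --> (0 : Cplx R)^'] --> lam a.
  have [mu_cont _] := mu_algebraic a; rewrite -(mu0 a).
  exact/continuous_withinNx/mu_cont.
have U_near : \forall l \near (0 : Cplx R)^', U l /\ l != 0.
  near=> l; split; last by near: l; exact: nbhs_dnbhs_neq.
  by near: l; apply: nbhs_dnbhs; exact: open_nbhs_nbhs.
split; first split.
- move=> x a i j; apply/eqO_exP.
  pose rem l := Sop_remainder B lam t eps_prim x a (mu l a) i j.
  have rem_cvg : rem l @[l --> (0 : Cplx R)^'] --> Sop_remainder B lam t eps_prim x a (lam a) i j.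
    exact: cvg_Sop_remainder.
  (* The remainder converges as l tends to 0, so the norm of its limit plus 1 bounds it near 0. *)
  exists (`|Sop_remainder B lam t eps_prim x a (lam a) i j| + 1).
    by rewrite ltr_wpDl.
  have rem_le : \forall l \near (0 : Cplx R)^',
      `|rem l| <= `|Sop_remainder B lam t eps_prim x a (lam a) i j| + 1.
    by apply: cvgr_norm_le rem_cvg _ _; rewrite ltrDl.
  apply: filterS2 U_near rem_le => l [Ul l0] rl.
  rewrite (Sop_expansion B eps_prim lamt_generic T_unit l0 (mu_den _ Ul l0) (mu_eq _ Ul l0)).
  by rewrite mxE normrM mulrC ler_wpM2r.
- move=> l Ul l0 x y.
  exact: (SopM eps_prim BkE BTE lamt_generic T_unit l0 (mu_den l Ul l0) (mu_eq l Ul l0)).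
- exact: (Lop_defined_near eps_prim lamt_generic T_unit _ mu_cvg).
- move=> l Ul l0 def.
  have S_invK := Sop_invK eps_prim BkE BTE lamt_generic T_unit l0 (mu_den _ Ul l0) def.
  have SK := SopK eps_prim BkE BTE lamt_generic T_unit l0 (mu_den _ Ul l0) def.
  have adj x := adjoint_Sop_inv k eps T B lam t l (mu l) x.
  split; first by eexists; split; [exact: SK | exact: S_invK | exact: adj].
  have Rlin : linear Rlam by exact: Rop_is_linear.
  pose Q : {linear matsum (Cplx R) m n -> matsum (Cplx R) m n} :=
    HB.pack Rlam (GRing.isLinear.Build _ _ _ _ Rlam Rlin).
  (* With L identified as the adjoint of the explicit inverse, the Lax equation follows from
     linearity of R and multiplicativity of S. *)
  have -> : Llam l = adjoint (Sop_inv k eps T B lam t l (mu l)) by apply/funext => x; rewrite adj.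
  apply: (@Lax_representation_adjoint_inv _ _ _ Q) => //.
  exact: (SopM eps_prim BkE BTE lamt_generic T_unit l0 (mu_den l Ul l0) (mu_eq l Ul l0)).
Unshelve. all: by end_near.
Qed.
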